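(* Let $G=(V,E,w)$ be a finite undirected loopless graph with $n$ vertices and nonnegative edge weights $w_e\ge 0$ ($e\in E$). Let $t\ge 0$ and $-1\le\vartheta\le 1$ be real numbers. For $0\le k\le n$ let $A_k$ and $D_k$ be the weighted adjacency and degree matrices of the $k$-token graph $F_k(G)$, put $H_k^{(\vartheta)}=A_k+\vartheta D_k$, and set $$a_k^{(\vartheta)}(t)=\mathbf{1}_k^{*}\,e^{tH_k^{(\vartheta)}}\,\mathbf{1}_k ,$$ where $\mathbf 1_k$ is the all-ones vector indexed by the $k$-subsets of $V$. Then, for $1\le k\le n-1$, $$\left(\frac{a_k^{(\vartheta)}(t)}{\binom nk}\right)^2\ \ge\ \frac{a_{k-1}^{(\vartheta)}(t)}{\binom n{k-1}}\cdot\frac{a_{k+1}^{(\vartheta)}(t)}{\binom n{k+1}}.$$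
   Context: Edges of $G$ are two-element subsets $\{i,j\}$ of $V$. No connectedness is assumed, and zero weights are allowed. For $0\le k\le n$, the weighted $k$-token graph $F_k(G)$ has vertex set $\binom{V}{k}=\{S\subseteq V:|S|=k\}$. Its weighted adjacency matrix $A_k$, indexed by $\binom Vk$, has entries $(A_k)_{S,T}=w_{\{i,j\}}$ if the symmetric difference $S\triangle T=\{i,j\}$ is an edge in $E$, and $(A_k)_{S,T}=0$ otherwise. Its weighted degree matrix is $D_k=\operatorname{diag}(d_k(S):S\in\binom Vk)$ with $d_k(S)=\sum_{e\in E,\ |S\cap e|=1}w_e$. For $k=0$ and $k=n$ these are the $1\times1$ zero matrices. $e^{M}$ is the matrix exponential and $^*$ denotes transpose. *)

(* Defs.v *)
From mathcomp Require Import all_boot all_order all_algebra.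
From mathcomp Require Import all_classical all_reals all_analysis.

Set Implicit Arguments.
Unset Strict Implicit.
Unset Printing Implicit Defensive.

Import Order.TTheory GRing.Theory Num.Theory.
Import numFieldNormedType.Exports.

Local Open Scope classical_set_scope.
Local Open Scope ring_scope.

(* The limit is taken in the normed topology of 'M[R]_n; the terms form an
   absolutely convergent series, so [lim] never takes its default value. *)
Definition expmx (R : realType) (n : nat) (M : 'M[R]_n) : 'M[R]_n :=
  lim (series (fun m : nat => (m`!%:R)^-1 *: (M ^+ m)) @ \oo).

Definition symdiff (T : finType) (A B : {set T}) : {set T} :=
  ((A :\: B) :|: (B :\: A))%SET.

Section TokenGraph.
Context {R : realType} {V : finType}.
(* A weighted graph on V is given by its edge set E, a set of two-element
   subsets of V, and weights w; only the values of w on E are ever used.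
   That the edges have two elements is a hypothesis of the theorem. *)
Variables (E : {set {set V}}) (w : {set V} -> R).

Definition ksubsets (k : nat) : {set {set V}} := [set S : {set V} | #|S| == k].

(* The bijection enum_val : 'I_#|ksubsets k| -> ksubsets k turns matrices
   indexed by k-subsets into matrices indexed by ordinals. *)
Definition token_adj (k : nat) : 'M[R]_#|ksubsets k| :=
  \matrix_(i, j)
    let D := symdiff (enum_val i) (enum_val j) in
    if D \in E then w D else 0.

Definition token_deg (S : {set V}) : R :=
  \sum_(e in E | #|(S :&: e)%SET| == 1%N) w e.

Definition token_degmx (k : nat) : 'M[R]_#|ksubsets k| :=
  diag_mx (\row_i token_deg (enum_val i)).

Definition token_H (theta : R) (k : nat) : 'M[R]_#|ksubsets k| :=
  token_adj k + theta *: token_degmx k.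

Definition ones (k : nat) : 'cV[R]_#|ksubsets k| := const_mx 1.

Definition token_a (theta : R) (k : nat) (t : R) : R :=
  ((ones k)^T *m expmx (t *: token_H theta k) *m ones k) 0 0.

End TokenGraph.

(* Main.v *)
From HB Require Import structures.
Require Import Defs.
From mathcomp Require Import all_boot all_order all_algebra.
From mathcomp Require Import complex ring lra zify.

Set Implicit Arguments.
Unset Strict Implicit.
Unset Printing Implicit Defensive.

Import Order.TTheory GRing.Theory Num.Theory.

Local Open Scope ring_scope.

(* Encode f : 2^V -> R as the multi-affine polynomial sum_S f(S) z^S and call f
   stable if this has no zero with all z_v in the open upper half-plane.  The
   all-ones function gives prod_v (1 + z_v), which is stable.  H is the sum over
   edges of w_e h_e, where for e = {i, j}, h_e maps
   a + b z_i + c z_j + d z_i z_j to (c + theta b) z_i + (b + theta c) z_j.  For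
   small s >= 0 the operator 1 + s h_e preserves stability exactly because
   -1 <= theta <= 1 (a statement about bilinear polynomials with complex
   coefficients).  By Lie-Trotter, e^(tH) 1 is a limit of stable functions u.
   On the diagonal z_v = x such a u gives the polynomial
   sum_k (sum_(|S| = k) u(S)) x^k, which is then real-rooted, so Newton's
   inequalities hold for its coefficients, and they pass to the limit. *)

(** * Bilinear polynomials without zeros in the upper half-plane *)

Section TwoVariables.
Variable R : rcfType.
Implicit Types (a b c d z : R[i]) (A B C D x y al be : R).
Local Notation Im := complex.Im.

Definition stable2 a b c d :=
  forall z1 z2, 0 < Im z1 -> 0 < Im z2 -> a + b * z1 + c * z2 + d * (z1 * z2) != 0.

Lemma stable2_sym a b c d : stable2 a b c d -> stable2 a c b d.
Proof.
by move=> h z1 z2 h1 h2; rewrite [a + _ + _]addrAC (mulrC z1); exact: h.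
Qed.

(** Letting y tend to 0 leaves a quadratic that is nonnegative on the real line, which gives [A] and
    the discriminant. Large y gives the sign of [D] and, if [D = 0], of [C]. *)
Lemma halfplane_form A B C D :
  (forall y x, 0 < y -> 0 <= A + B * x + C * y + D * (x ^+ 2 + y ^+ 2)) ->
  [/\ 0 <= A, 0 <= D, B ^+ 2 <= 4 * A * D & (D = 0 -> 0 <= C)].
Proof.
move=> h.
have hq x : 0 <= A + B * x + D * x ^+ 2.
  rewrite leNgt; apply/negP; set q := A + _ + _ => q0.
  (* Chosen so that y (C + D y) <= y M <= -q/2: a negative [q] would make the form negative at (x,
     y). *)
  pose M := `|C| + `|D| + 1.
  have M0 : 1 <= M by rewrite /M lerDr addr_ge0.
  pose y := Num.min 1 (- q / (2 * M)).
  have y0 : 0 < y by rewrite lt_min ltr01 divr_gt0 ?oppr_gt0//; lra.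
  have y1 : y <= 1 by rewrite ge_min lexx.
  have yq : y * (2 * M) <= - q.
    rewrite -ler_pdivlMr; last lra.
    by rewrite ge_min lexx orbT.
  have := h y x y0.
  have -> : A + B * x + C * y + D * (x ^+ 2 + y ^+ 2) = q + y * (C + D * y).
    by rewrite /q; ring.
  have : C + D * y <= M.
    have h1 := ler_norm C; have h2 : D * y <= `|D|.
      apply: le_trans (ler_norm _) _; rewrite normrM (gtr0_norm y0).
      by rewrite ler_piMr.
    rewrite /M; lra.
  move=> /(ler_wpM2l (ltW y0)); nra.
have A0 : 0 <= A by have := hq 0; rewrite expr0n /= !mulr0 !addr0.
have D0 : 0 <= D.
  rewrite leNgt; apply/negP => D0.
  pose y := (`|A| + `|C| + 1) / (- D) + 1.
  have nA := ler_norm A; have nC := ler_norm C.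
  have hA := normr_ge0 A; have hC := normr_ge0 C.
  have y1 : 1 <= y by rewrite lerDr divr_ge0 //; lra.
  have yD : D * y = - (`|A| + `|C| + 1) + D by rewrite /y; field; lra.
  have /(h _ 0) : 0 < y by lra.
  rewrite expr0n /= mulr0 addr0 add0r expr2 mulrA yD; nra.
have disc : B ^+ 2 <= 4 * A * D.
  have [D1|D1] := eqVneq D 0.
    rewrite D1 mulr0; have [->|B0] := eqVneq B 0; first by rewrite expr0n.
    have := hq (- (A + 1) / B); rewrite D1 mul0r addr0 mulrC divfK//; lra.
  have Dp : 0 < D by rewrite lt_def D1.
  have := hq (- B / (2 * D)).
  have -> : A + B * (- B / (2 * D)) + D * (- B / (2 * D)) ^+ 2 = 
      (4 * A * D - B ^+ 2) / (4 * D) by field.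
  by rewrite pmulr_lge0 ?subr_ge0// invr_gt0; lra.
split=> // D1; rewrite D1 in h.
rewrite leNgt; apply/negP => C0.
have /(h _ 0) : 0 < (A + 1) / (- C) by apply: divr_gt0; lra.
rewrite mulr0 mul0r !addr0 invrN mulrN mulrN mulrC divfK ?lt_eqF//; lra.
Qed.

(** A negative value forces b + d z to be nonzero and puts the root z1 = -(a + c z)/(b + d z) in the
    upper half-plane, as Im z1 is minus that value over |b + d z|^2. *)
Lemma stable2_Im a b c d z : stable2 a b c d -> 0 < Im z ->
  0 <= Im ((a + c * z) * conjc (b + d * z)).
Proof.
move=> st z0; rewrite leNgt; apply/negP.
case Ep: (a + c * z) => [p1 p2]; case Eq: (b + d * z) => [q1 q2] /=.
move=> h; pose N := q1 ^+ 2 + q2 ^+ 2.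
have N0 : 0 < N.
  rewrite lt_def /N paddr_eq0 ?sqr_ge0// !sqrf_eq0 addr_ge0 ?sqr_ge0// andbT.
  apply/negP => /andP[/eqP q10 /eqP q20].
  by move: h; rewrite q10 q20 !mulr0; lra.
pose z1 : R[i] := Complex (- (p1 * q1 + p2 * q2) / N) (- (p2 * q1 - p1 * q2) / N).
have z1H : 0 < Im z1 by apply: divr_gt0 => //; lra.
have /eqP := st z1 z z1H z0; apply.
have -> : a + b * z1 + c * z + d * (z1 * z) = (a + c * z) + (b + d * z) * z1 by ring.
rewrite Ep Eq; apply/eqP; rewrite eq_complex /=; apply/andP; split; apply/eqP.
  by rewrite /N; field; rewrite gt_eqF.
by rewrite /N; field; rewrite gt_eqF.
Qed.

Local Notation imc a b := (Im (a * conjc b)).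
Local Notation rec a b := (complex.Re (a * conjc b)).

(* For fixed z2 = x + i y the polynomial (a + c z2) + (b + d z2) z1 is affine
   in z1, and its root avoids the upper half-plane iff this form is
   nonnegative.  So stability is positivity of a real quadratic form for y > 0. *)
Lemma form_expand a b c d x y :
  Im ((a + c * Complex x y) * conjc (b + d * Complex x y)) =
  imc a b + (imc a d + imc c b) * x + (rec c b - rec a d) * y +
  imc c d * (x ^+ 2 + y ^+ 2).
Proof. by case: a b c d => [a1 a2] [b1 b2] [c1 c2] [d1 d2] /=; ring. Qed.

Lemma stable2_form a b c d : stable2 a b c d ->
  [/\ 0 <= imc a b, 0 <= imc c d,
      (imc a d + imc c b) ^+ 2 <= 4 * imc a b * imc c d &
      imc c d = 0 -> 0 <= rec c b - rec a d].
Proof.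
move=> st; apply: halfplane_form => y x y0.
by rewrite -form_expand; exact: stable2_Im.
Qed.

(** When Im(c conj d) > 0, positivity of the form leaves the sign of its y-coefficient open.
    Exchanging the variables also gives Im(b conj d) >= 0, which settles it. *)
Lemma stable2_cross a b c d : stable2 a b c d -> 0 <= rec c b - rec a d.
Proof.
move=> st; have [A0 D0 dB CD0] := stable2_form st.
have [_ D1 _ _] := stable2_form (stable2_sym st).
have [/CD0//|Dn0] := eqVneq (imc c d) 0.
have Dp : 0 < imc c d by rewrite lt_def Dn0.
rewrite leNgt; apply/negP => Cneg.
pose B := imc a d + imc c b; pose C := rec c b - rec a d.
have y0 : 0 < - C / (2 * imc c d) by apply: divr_gt0; rewrite /C; lra.
have := @stable2_Im a b c d (Complex (- B / (2 * imc c d)) (- C / (2 * imc c d))) st y0.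
rewrite form_expand -/B -/C.
have -> : imc a b + B * (- B / (2 * imc c d)) + C * (- C / (2 * imc c d)) +
     imc c d * ((- B / (2 * imc c d)) ^+ 2 + (- C / (2 * imc c d)) ^+ 2)
  = (4 * imc a b * imc c d - B ^+ 2 - C ^+ 2) / (4 * imc c d) by field.
rewrite pmulr_lge0; last by rewrite invr_gt0; lra.
move=> disc.
(* If C were negative, the minimum of the form over y > 0 would force
   a d = b c, and then C can be read off to be nonnegative. *)
have key : C ^+ 2 + B ^+ 2 - 4 * imc a b * imc c d =
    complex.Re (a * d - b * c) ^+ 2 + Im (a * d - b * c) ^+ 2.
  rewrite /B /C; clear; case: a b c d => [a1 a2] [b1 b2] [c1 c2] [d1 d2] /=; ring.
have /andP[/eqP Re0 /eqP Im0] :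
    (complex.Re (a * d - b * c) == 0) && (Im (a * d - b * c) == 0).
  rewrite -(sqrf_eq0 (complex.Re _)) -(sqrf_eq0 (Im _)) -paddr_eq0 ?sqr_ge0//.
  by rewrite eq_le addr_ge0 ?sqr_ge0// andbT; lra.
have := mulr_ge0 D1 D0.
move: Re0 Im0 Cneg Dp; clear; case: a b c d => [a1 a2] [b1 b2] [c1 c2] [d1 d2] /=.
set D := _ * - d2 + _ => Re0 Im0 Cneg Dp DD.
(* With C the y-coefficient and a d = b c, this is C |d|^2 = 2 Im(b conj d) Im(c conj d). *)
have : (c1 * b1 - c2 * - b2 - (a1 * d1 - a2 * - d2)) * (d1 ^+ 2 + d2 ^+ 2) =
   2 * ((b1 * - d2 + b2 * d1) * D).
  apply/eqP; rewrite -subr_eq0; apply/eqP.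
  transitivity (- (a1 * d1 - a2 * d2 - (b1 * c1 - b2 * c2)) * (d1 ^+ 2 - d2 ^+ 2)
     - (a1 * d2 + a2 * d1 - (b1 * c2 + b2 * c1)) * (2 * d1 * d2)).
    by rewrite /D; ring.
  by rewrite Re0 Im0; ring.
have d0 : 0 < d1 ^+ 2 + d2 ^+ 2.
  rewrite lt_def paddr_eq0 ?sqr_ge0// !sqrf_eq0 addr_ge0 ?sqr_ge0// andbT.
  by apply/negP => /andP[/eqP d10 /eqP d20]; move: Dp; rewrite /D d10 d20; lra.
move=> h; have : 0 <= 2 * ((b1 * - d2 + b2 * d1) * D) by rewrite mulr_ge0.
by rewrite -h pmulr_lge0 //; lra.
Qed.

(** By AM-GM, (B0 B1)^2 <= 16 A0 D0 A1 D1 <= 4 (A0 D1 + A1 D0)^2. *)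
Lemma mul_mean_le A0 D0 A1 D1 B0 B1 : 0 <= A0 -> 0 <= D0 -> 0 <= A1 -> 0 <= D1 ->
  B0 ^+ 2 <= 4 * A0 * D0 -> B1 ^+ 2 <= 4 * A1 * D1 ->
  `|B0| * `|B1| <= 2 * (A0 * D1 + A1 * D0).
Proof.
move=> hA0 hD0 hA1 hD1 h0 h1.
rewrite -normrM -[leRHS]ger0_norm; last by rewrite mulr_ge0// addr_ge0// mulr_ge0.
rewrite -ler_sqr ?nnegrE// !real_normK ?num_real// exprMn.
have := ler_pM (sqr_ge0 B0) (sqr_ge0 B1) h0 h1.
have := sqr_ge0 (A0 * D1 - A1 * D0); nra.
Qed.

(** Substituting a = -b (x + i y) gives Im(a conj b) = -y |b|^2. *)
Lemma mulc_conj_eq0 a b x y : 0 < y -> imc a b = 0 ->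
  a + b * Complex x y = 0 -> a = 0 /\ b = 0.
Proof.
move=> y0; case: a b => [a1 a2] [b1 b2] /= h.
move/eqP; rewrite eq_complex /= => /andP[/eqP e1 /eqP e2].
have ha1 : a1 = - (b1 * x - b2 * y) by lra.
have ha2 : a2 = - (b1 * y + b2 * x) by lra.
have : y * (b1 ^+ 2 + b2 ^+ 2) = 0 by rewrite -oppr0 -h ha1 ha2; ring.
move=> /eqP; rewrite mulf_eq0 gt_eqF//= paddr_eq0 ?sqr_ge0// !sqrf_eq0.
by move=> /andP[/eqP b10 /eqP b20]; rewrite ha1 ha2 b10 b20 !mul0r !(addr0, subr0, oppr0).
Qed.

(** The worst case is m = 2 |rho|, where the expression is rho ((al + be)^2 - 1) or -rho (1 - (al -
    be)^2), according to the sign of rho. *)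
Lemma mix_cross_le (al be : R) (al0 : 0 < al) (be0 : 0 <= be) (sum1 : 1 <= al + be)
  (dif1 : al - be <= 1) (dif2 : -1 <= al - be) (m rho : R) : 2 * `|rho| <= m ->
  0 <= al * be * m + (al ^+ 2 + be ^+ 2 - 1) * rho.
Proof.
move=> hm.
have hab : 0 <= al * be by rewrite mulr_ge0// ltW.
have hp : 0 <= (al + be) ^+ 2 - 1.
  by rewrite subr_sqr_1; apply: mulr_ge0; lra.
have hd : 0 <= 1 - (al - be) ^+ 2.
  have -> : 1 - (al - be) ^+ 2 = (1 - (al - be)) * (1 + (al - be)) by ring.
  by apply: mulr_ge0; lra.
have := ler_wpM2l hab hm.
case: (ger0P rho) => r0.
  have := mulr_ge0 r0 hp; lra.
have r1 : 0 <= - rho by lra.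
have := mulr_ge0 r1 hd; lra.
Qed.

(** P + S and P - S are the x-coefficients of the form before and after exchanging b and c. The new
    x-coefficient combines them with weights (1 + delta)/2 and (1 - delta)/2, delta = al^2 - be^2.
    These are at most al and be in absolute value because 1, al, be satisfy the triangle
    inequalities. *)
Lemma mix_disc (al be : R) (al0 : 0 < al) (be0 : 0 <= be) (sum1 : 1 <= al + be)
  (dif1 : al - be <= 1) (dif2 : -1 <= al - be) (A0 A1 D0 D1 P S : R) :
  0 <= A0 -> 0 <= D0 -> 0 <= A1 -> 0 <= D1 ->
  (P + S) ^+ 2 <= 4 * A0 * D0 -> (P - S) ^+ 2 <= 4 * A1 * D1 ->
  (P + (al ^+ 2 - be ^+ 2) * S) ^+ 2 <=
  4 * (al * A0 + be * A1) * (al * D0 + be * D1).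
Proof.
move=> hA0 hD0 hA1 hD1 h0 h1.
have hm := mul_mean_le hA0 hD0 hA1 hD1 h0 h1.
set B0 := P + S in h0 hm; set B1 := P - S in h1 hm.
have hal := ltW al0.
have bnd : `|P + (al ^+ 2 - be ^+ 2) * S| <= al * `|B0| + be * `|B1|.
  have -> : P + (al ^+ 2 - be ^+ 2) * S =
     (1 + (al ^+ 2 - be ^+ 2)) / 2 * B0 + (1 - (al ^+ 2 - be ^+ 2)) / 2 * B1.
    by rewrite /B0 /B1; field.
  apply: le_trans (ler_normD _ _) _; rewrite (normrM _ B0) (normrM _ B1).
  apply: lerD; apply: ler_wpM2r => //; rewrite ler_norml; apply/andP; split; nra.
rewrite -real_normK ?num_real//.
have : `|P + (al ^+ 2 - be ^+ 2) * S| ^+ 2 <= (al * `|B0| + be * `|B1|) ^+ 2.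
  by rewrite ler_sqr ?nnegrE// addr_ge0// mulr_ge0.
move=> /le_trans; apply.
have := ler_wpM2l (mulr_ge0 hal be0) hm.
have := ler_wpM2l (mulr_ge0 hal hal) h0.
have := ler_wpM2l (mulr_ge0 be0 be0) h1.
rewrite -(real_normK (num_real B0)) -(real_normK (num_real B1)).
lra.
Qed.

(* With al = 1 + s theta and be = s, the three inequalities say exactly that
   -1 <= theta <= 1 (for small s >= 0). *)
Lemma stable2_mix (al be : R) (al0 : 0 < al) (be0 : 0 <= be) (sum1 : 1 <= al + be)
  (dif1 : al - be <= 1) (dif2 : -1 <= al - be) a b c d : stable2 a b c d ->
  stable2 a (al%:C%C * b + be%:C%C * c) (al%:C%C * c + be%:C%C * b) d.
Proof.
move=> st.
have [be_eq0|be_neq0] := eqVneq be 0.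
  have al1 : al = 1 by lra.
  move=> z1 z2 h1 h2; rewrite be_eq0 al1 !mul0r !mul1r !addr0; exact: st.
have [A0 D0 dB _] := stable2_form st.
have [A1 D1 dB1 _] := stable2_form (stable2_sym st).
have C0 := stable2_cross st.
have bep : 0 < be by rewrite lt_def be_neq0.
set b' := _ + _; set c' := _ + _.
have eA : imc a b' = al * imc a b + be * imc a c.
  by rewrite /b'; clear; case: a b c => [a1 a2] [b1 b2] [c1 c2] /=; ring.
have eA1 : imc a c' = al * imc a c + be * imc a b.
  by rewrite /c'; clear; case: a b c => [a1 a2] [b1 b2] [c1 c2] /=; ring.
have eD : imc c' d = al * imc c d + be * imc b d.
  by rewrite /c'; clear; case: d b c => [a1 a2] [b1 b2] [c1 c2] /=; ring.
have eD1 : imc b' d = al * imc b d + be * imc c d.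
  by rewrite /b'; clear; case: d b c => [a1 a2] [b1 b2] [c1 c2] /=; ring.
have eS : imc c' b' = (al ^+ 2 - be ^+ 2) * imc c b.
  by rewrite /b' /c'; clear; case: b c => [b1 b2] [c1 c2] /=; ring.
have eS1 : imc b c = - imc c b.
  by clear; case: b c => [b1 b2] [c1 c2] /=; ring.
pose nb := complex.Re b ^+ 2 + Im b ^+ 2 + (complex.Re c ^+ 2 + Im c ^+ 2).
have eC : rec c' b' = rec c b + (al * be * nb + (al ^+ 2 + be ^+ 2 - 1) * rec c b).
  by rewrite /b' /c' /nb; clear; case: b c => [b1 b2] [c1 c2] /=; ring.
have hnb : 2 * `|rec c b| <= nb.
  suff : 2 * rec c b <= nb /\ - (2 * rec c b) <= nb.
    by case: (ger0P (rec c b)) => h [? ?]; lra.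
  rewrite /nb; clear; case: b c => [b1 b2] [c1 c2] /=; split; rewrite -subr_ge0.
    have -> : b1 ^+ 2 + b2 ^+ 2 + (c1 ^+ 2 + c2 ^+ 2) - 2 * (c1 * b1 - c2 * - b2) =
      (b1 - c1) ^+ 2 + (b2 - c2) ^+ 2 by ring.
    by rewrite addr_ge0 ?sqr_ge0.
  have -> : b1 ^+ 2 + b2 ^+ 2 + (c1 ^+ 2 + c2 ^+ 2) - - (2 * (c1 * b1 - c2 * - b2)) =
    (b1 + c1) ^+ 2 + (b2 + c2) ^+ 2 by ring.
  by rewrite addr_ge0 ?sqr_ge0.
have hC := mix_cross_le al0 be0 sum1 dif1 dif2 hnb.
rewrite eS1 in dB1.
have hdisc := mix_disc al0 be0 sum1 dif1 dif2 A0 D0 A1 D1 dB dB1.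
rewrite -eS -eA -eD in hdisc.
move=> z1 [x y] z1H /= y0; apply/negP => /eqP hz.
set z2 := Complex x y in hz.
have hAB : (a + c' * z2) + (b' + d * z2) * z1 = 0 by rewrite -hz; ring.
have form := form_expand a b' c' d x y.
have A'0 : 0 <= imc a b' by rewrite eA addr_ge0// mulr_ge0// ltW.
have D'0 : 0 <= imc c' d by rewrite eD addr_ge0// mulr_ge0// ltW.
have C'0 : 0 <= rec c' b' - rec a d by rewrite eC; lra.
(* [q] is the form continued to y = 0; the remaining terms in y are nonnegative. *)
pose q := imc a b' + (imc a d + imc c' b') * x + imc c' d * x ^+ 2.
have q0 : 0 <= q.
  rewrite /q; have [Dz|Dn] := eqVneq (imc c' d) 0.
    move: hdisc; rewrite Dz mulr0 mul0r addr0.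
    by rewrite real_exprn_even_le0 ?num_real//= => /eqP ->; rewrite mul0r addr0.
  have Dp : 0 < imc c' d by rewrite lt_def Dn.
  rewrite -(pmulr_rge0 _ Dp); have := sqr_ge0 (2 * imc c' d * x + (imc a d + imc c' b')).
  move: hdisc; nra.
have form' : Im ((a + c' * z2) * conjc (b' + d * z2)) =
    q + (rec c' b' - rec a d) * y + imc c' d * y ^+ 2.
  by rewrite form /q; ring.
have hCy := mulr_ge0 C'0 (ltW y0).
have hDy := mulr_ge0 D'0 (sqr_ge0 y).
(* A zero with z1 in the upper half-plane makes the form nonpositive, hence
   everything degenerates: a, b, c, d are then real multiples of each other. *)
have [A_0 B_0] : a + c' * z2 = 0 /\ b' + d * z2 = 0.
  move: z1H hAB form'; clear - q0 hCy hDy.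
  move: (a + c' * z2) (b' + d * z2) => [p1 p2] [q1 q2]; case: z1 => [x1 y1] /=.
  move=> y1p /eqP; rewrite eq_complex /= => /andP[/eqP e1 /eqP e2].
  have -> : p1 = - (q1 * x1 - q2 * y1) by lra.
  have -> : p2 = - (q1 * y1 + q2 * x1) by lra.
  have -> : - (q1 * x1 - q2 * y1) * - q2 + - (q1 * y1 + q2 * x1) * q1 =
    - (y1 * (q1 ^+ 2 + q2 ^+ 2)) by ring.
  move=> h.
  have hq : 0 <= y1 * (q1 ^+ 2 + q2 ^+ 2) by rewrite mulr_ge0 ?addr_ge0 ?sqr_ge0// ltW.
  have : y1 * (q1 ^+ 2 + q2 ^+ 2) == 0 by apply/eqP; lra.
  rewrite mulf_eq0 gt_eqF//= paddr_eq0 ?sqr_ge0// !sqrf_eq0.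
  by move=> /andP[/eqP -> /eqP ->]; rewrite !mul0r subrr addr0 oppr0.
move: form'; rewrite A_0 mul0r /= => form'.
have C'z : rec c' b' - rec a d = 0.
  have : (rec c' b' - rec a d) * y == 0 by apply/eqP; lra.
  by rewrite mulf_eq0 (gt_eqF y0) orbF => /eqP.
have D'z : imc c' d = 0.
  have : imc c' d * y ^+ 2 == 0 by apply/eqP; lra.
  by rewrite mulf_eq0 sqrf_eq0 (gt_eqF y0) orbF => /eqP.
have qz : q = 0 by rewrite C'z D'z in form'; lra.
have A'z : imc a b' = 0.
  move: hdisc qz; rewrite /q D'z mulr0 mul0r addr0.
  by rewrite real_exprn_even_le0 ?num_real//= => /eqP ->; rewrite mul0r addr0.
have pz u v : 0 <= u -> 0 <= v -> al * u + be * v = 0 -> u = 0 /\ v = 0.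
  move=> u0 v0 /eqP; rewrite paddr_eq0 ?mulr_ge0// 1?ltW//.
  by rewrite !mulf_eq0 (gt_eqF al0) (gt_eqF bep) /= => /andP[/eqP-> /eqP->].
have [Az A1z] : imc a b = 0 /\ imc a c = 0 by apply: pz => //; rewrite -eA.
have [Dz D1z] : imc c d = 0 /\ imc b d = 0 by apply: pz => //; rewrite -eD.
have [b'0 d0] : b' = 0 /\ d = 0.
  by apply: mulc_conj_eq0 y0 _ B_0; rewrite eD1 Dz D1z !mulr0 addr0.
have [a0 c'0] : a = 0 /\ c' = 0.
  by apply: mulc_conj_eq0 y0 _ A_0; rewrite eA1 Az A1z !mulr0 addr0.
(* Since a = 0, [rec c b] and the nonnegative correction [hC] add up to 0. *)
have Cz : rec c b = 0.
  have e0 : rec a d = 0 by rewrite a0 mul0r.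
  rewrite e0 in C0 C'z; rewrite eC in C'z; lra.
have [bz cz] : b = 0 /\ c = 0.
  move: b'0 c'0 Cz; rewrite /b' /c'; clear - al0 bep.
  case: b c => [b1 b2] [c1 c2].
  move=> /eqP; rewrite eq_complex /= => /andP[/eqP e1 /eqP e2].
  move=> /eqP; rewrite eq_complex /= => /andP[/eqP e3 /eqP e4] e5.
  (* From al b = -be c follows al |b|^2 = -be Re(c conj b) = 0. *)
  have : al * (b1 ^+ 2 + b2 ^+ 2) = 0.
    transitivity (b1 * (al * b1 - 0 * b2 + (be * c1 - 0 * c2)) +
       b2 * (al * b2 + 0 * b1 + (be * c2 + 0 * c1)) - be * (c1 * b1 - c2 * - b2)).
      by ring.
    by rewrite e1 e2 e5; ring.
  move=> /eqP; rewrite mulf_eq0 gt_eqF//= paddr_eq0 ?sqr_ge0// !sqrf_eq0.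
  move=> /andP[/eqP b10 /eqP b20]; rewrite b10 b20 in e1 e2 *.
  have : be * c1 == 0 by apply/eqP; lra.
  have : be * c2 == 0 by apply/eqP; lra.
  by rewrite !mulf_eq0 (gt_eqF bep) /= => /eqP -> /eqP ->.
have /eqP := st 'i%C 'i%C ltr01 ltr01.
by rewrite a0 bz cz d0 !mul0r !addr0.
Qed.
End TwoVariables.

(** * Newton's inequalities *)

Section Newton.
Variable R : rcfType.
Implicit Types (r : R) (rs : seq R) (q : nat -> R).

Definition ultra_log_concave (a : nat -> R) (n : nat) :=
  forall k, (0 < k < n)%N ->
  a k.-1 / 'C(n, k.-1)%:R * (a k.+1 / 'C(n, k.+1)%:R) <= (a k / 'C(n, k)%:R) ^+ 2.

(** Induction on the linear factors, with [q] the coefficients divided by binomials. Positivity of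
    [q] is carried along because one step divides by it. *)
Lemma newton_prod rs : all (> 0) rs ->
  let n := size rs in
  exists q, [/\ forall k, (k <= n)%N -> 0 < q k,
    forall k, (\prod_(r <- rs) ('X + r%:P))`_k = 'C(n, k)%:R * q k &
    forall k, (0 < k < n)%N -> q k.-1 * q k.+1 <= q k ^+ 2].
Proof.
elim: rs => [|r rs IH] /=.
  move=> _; exists (fun=> 1); split=> [//||[|k]//].
  by move=> k; rewrite big_nil coef1 bin0n mulr1; case: k.
move=> /andP[r0 /IH[q [q0 qE qlc]]] {IH}; set n := size rs in q0 qE qlc *.
(* The rule c'_k = r c_k + c_(k-1), divided by C(n+1, k). At k = 0 and k = n + 1 a weight vanishes
   and cancels the out-of-range value of [q]. *)
pose q' k := ((n.+1 - k)%:R * r * q k + k%:R * q k.-1) / n.+1%:R.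
have N0 : (0 : R) < n.+1%:R by rewrite ltr0n.
have Nn0 : n.+1%:R != 0 :> R by rewrite gt_eqF.
exists q'; split.
- case=> [_|k].
    by rewrite /q' mul0r addr0 subn0 divr_gt0// !mulr_gt0// q0.
  rewrite /q' ltnS /= => kn; rewrite divr_gt0//; apply: ltr_wpDl.
    move: kn; rewrite leq_eqVlt => /predU1P[->|kn]; first by rewrite subnn !mul0r.
    by rewrite mulr_ge0 ?(ltW (q0 _ _)) ?mulr_ge0 ?(ltW r0).
  by rewrite mulr_gt0 ?q0.
- move=> k; rewrite big_cons mulrDl coefD coefXM coefCM !qE.
  case: k => [|k] /=.
    by rewrite /q' !bin0 subn0 mul0r addr0 add0r !mul1r; apply: (canRL (mulfK Nn0)); ring.
  rewrite /q' /=.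
  have e1 : (k.+1%:R : R) * 'C(n.+1, k.+1)%:R = n.+1%:R * 'C(n, k)%:R.
    by rewrite -!natrM -mul_bin_diag.
  have e2 : ((n.+1 - k.+1)%:R : R) * 'C(n.+1, k.+1)%:R = n.+1%:R * 'C(n, k.+1)%:R.
    by rewrite -!natrM -mul_bin_down.
  rewrite mulrA; apply: (canRL (mulfK Nn0)).
  transitivity (n.+1%:R * 'C(n, k)%:R * q k + r * (n.+1%:R * 'C(n, k.+1)%:R * q k.+1)).
    by ring.
  by rewrite -e1 -e2; ring.
- move=> k /andP[k0]; rewrite ltnS => kn.
  rewrite /q' expr_div_n mulf_div -expr2 ler_pM2r ?invr_gt0 ?exprn_gt0//=.
  have eK : k.-1%:R = k%:R - 1 :> R by rewrite -subn1 natrB.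
  have eK1 : k.+1%:R = k%:R + 1 :> R by rewrite -natr1.
  have M1 : (1 <= n.+1 - k)%N by rewrite subn_gt0 ltnS.
  have eM : (n.+1 - k.+1)%:R = (n.+1 - k)%:R - 1 :> R.
    by rewrite -[k.+1]addn1 subnDA natrB.
  have eM1 : (n.+1 - k.-1)%:R = (n.+1 - k)%:R + 1 :> R.
    by rewrite natr1 -subSn 1?ltnW// -{2}(prednK k0) subSS.
  rewrite eK eK1 eM eM1.
  have K1 : (1 : R) <= k%:R by rewrite ler1n.
  have M1' : (1 : R) <= (n.+1 - k)%:R by rewrite ler1n.
  have hK : 0 <= (k%:R - 1) * (q k.-1 ^+ 2 - q k.-2 * q k).
    case: k k0 kn {eK eK1 eM eM1 M1 M1' K1} => [|[|k]] //= _ kn.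
      by rewrite subrr mul0r.
    by rewrite mulr_ge0 ?subr_ge0 ?ler1n// (qlc k.+1) //=.
  have hM : 0 <= ((n.+1 - k)%:R - 1) * (q k ^+ 2 - q k.-1 * q k.+1).
    rewrite -eM subSS; move: kn; rewrite leq_eqVlt => /predU1P[<-|kn].
      by rewrite subnn mul0r.
    by rewrite mulr_ge0// subr_ge0 qlc// k0.
  (* The inequality q_(k-2) q_(k+1) <= q_(k-1) q_k is the product of those at k - 1 and k, divided
     by q_(k-1) q_k. *)
  have hKM : 0 <= (k%:R - 1) * ((n.+1 - k)%:R - 1) * (q k.-1 * q k - q k.-2 * q k.+1).
    rewrite -eM subSS; move: kn; rewrite leq_eqVlt => /predU1P[<-|kn].
      by rewrite subnn mulr0 mul0r.
    case: k k0 kn {eK eK1 eM eM1 M1 M1' K1 hK hM} => [|[|k]] //= _ kn.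
      by rewrite subrr !mul0r.
    rewrite mulr_ge0 ?mulr_ge0 ?subr_ge0 ?ler1n//.
    have l1 : q k * q k.+2 <= q k.+1 ^+ 2 by apply: (qlc k.+1); rewrite /= ltnW.
    have l2 : q k.+1 * q k.+3 <= q k.+2 ^+ 2 by apply: (qlc k.+2).
    have a0 : 0 < q k by apply: q0; apply: leq_trans kn; rewrite -addn3 leq_addr.
    have b0 : 0 < q k.+1 by rewrite q0// ltnW// ltnW.
    have c0 : 0 < q k.+2 by rewrite q0// ltnW.
    have d0 : 0 < q k.+3 by rewrite q0.
    rewrite -(ler_pM2l (mulr_gt0 b0 c0)).
    have := ler_pM (ltW (mulr_gt0 a0 c0)) (ltW (mulr_gt0 b0 d0)) l1 l2.
    lra.
  move: hK hM hKM; move: (q k.-2) (q k.-1) (q k) (q k.+1) => a b c d.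
  move: K1 M1'; move: k%:R (n.+1 - k)%:R => K M K1 M1' hK hM hKM.
  rewrite -subr_ge0.
  (* Here M = n + 1 - k and a, b, c, d = q_(k-2), ..., q_(k+1); every summand on
     the right is nonnegative. *)
  have -> : ((M * r * c + K * b) ^+ 2 - ((M + 1) * r * b + (K - 1) * a) *
     ((M - 1) * r * d + (K + 1) * c)) =
     (r * c - b) ^+ 2 + r ^+ 2 * (M + 1) * ((M - 1) * (c ^+ 2 - b * d)) +
     (K + 1) * ((K - 1) * (b ^+ 2 - a * c)) +
     r * ((K - 1) * (M - 1) * (b * c - a * d)) by ring.
  have [Kp Mp rp] : [/\ 0 <= K + 1, 0 <= M + 1 & 0 <= r] by split; lra.
  by rewrite !addr_ge0 ?sqr_ge0// mulr_ge0// mulr_ge0// sqr_ge0.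
Qed.

Local Notation Im := complex.Im.

(** Conjugation excludes roots in the lower half-plane as well, so all roots are real. Nonnegative
    coefficients and a positive constant term make them negative, and [newton_prod] applies to their
    opposites. *)
Lemma ultra_log_concave_coef (p : {poly R}) :
  (forall k, 0 <= p`_k) -> 0 < p`_0 ->
  (forall z : R[i], 0 < Im z -> (map_poly (real_complex R) p).[z] != 0) ->
  ultra_log_concave (fun k => p`_k) (size p).-1.
Proof.
move=> p_ge0 p0 hst.
have pn0 : p != 0 by apply: contraTneq p0 => ->; rewrite coef0 ltxx.
pose P := map_poly (real_complex R) p.
have [zs zsE] := closed_field_poly_normal P.
have Pn0 : P != 0 by rewrite map_poly_eq0.
have rootP z : z \in zs -> P.[z] = 0.
  move=> zz; apply/eqP; rewrite -/(root P z) zsE rootZ ?lead_coef_eq0//.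
  by rewrite root_prod_XsubC.
have zreal z : z \in zs -> Im z = 0 /\ complex.Re z < 0.
  move=> zz; have zr := rootP _ zz.
  have i0 : Im z = 0.
    apply/eqP; case: ltgtP => // h.
      have : P.[conjc z] == 0.
        have : conjc P.[z] = 0 by rewrite zr conjc0.
        rewrite /P -horner_map -map_poly_comp => <-.
        apply/eqP; congr (_.[_]); apply: eq_map_poly => x /=.
        by rewrite oppr0.
      by rewrite (negPf (hst _ _))//; case: {zz zr} z h => x y /=; rewrite oppr_gt0.
    by have := hst _ h; rewrite -/P zr eqxx.
  split=> //; rewrite ltNge; apply/negP => re0.
  move: zr; rewrite (complexE z) i0 mulr0 addr0 /P horner_map => /eqP.
  rewrite fmorph_eq0 => /eqP hz.
  move: p0; rewrite lt_neqAle => /andP[/eqP + _]; apply.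
  move: hz; rewrite horner_coef.
  move: pn0; rewrite -size_poly_gt0; case: (size p) => // n _.
  rewrite big_ord_recl expr0 mulr1 => /eqP; rewrite paddr_eq0//; last first.
    by apply: sumr_ge0 => i _; rewrite mulr_ge0// exprn_ge0.
  by move=> /andP[/eqP].
pose rs := [seq - complex.Re z | z <- zs].
have rs0 : all (> 0) rs.
  by apply/allP => _ /mapP[z /zreal[_ h] ->]; rewrite oppr_gt0.
have pE : p = lead_coef p *: \prod_(r <- rs) ('X + r%:P).
  apply: (map_poly_inj (real_complex R)); rewrite -/P zsE map_polyZ lead_coef_map.
  congr (_ *: _); rewrite rmorph_prod big_map; apply: eq_big_seq => z /zreal[i0 _].
  rewrite rmorphD /= map_polyX map_polyC /= rmorphN /= polyCN.
  by congr (_ - _%:P); rewrite [LHS]complexE i0 mulr0 addr0.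
have [q [q0 qE qlc]] := newton_prod rs0.
have sp : (size p).-1 = size rs.
  have : size P = (size zs).+1.
    by rewrite zsE size_scale ?lead_coef_eq0// size_prod_XsubC.
  by rewrite size_map_poly /rs size_map => ->.
move=> k; rewrite sp => /andP[k0 kn].
have lc j : (j <= size rs)%N -> p`_j / 'C(size rs, j)%:R = lead_coef p * q j.
  move=> jn; rewrite {1}pE coefZ qE -mulrA; congr (_ * _).
  by rewrite mulrC mulKf// pnatr_eq0 -lt0n bin_gt0.
rewrite !lc ?(ltnW kn)//; last by rewrite (leq_trans (leq_pred _)) // ltnW.
rewrite exprMn mulrACA -expr2 ler_wpM2l ?sqr_ge0//.
by apply: qlc; rewrite k0.
Qed.
End Newton.

(** * Stable set functions *)

Section SetPolynomials.
Variables (R : rcfType) (V : finType).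
Implicit Types (f : {set V} -> R) (z : V -> R[i]) (S e : {set V}).
Local Notation Im := complex.Im.

Definition setpoly f z : R[i] := \sum_(S : {set V}) (f S)%:C%C * \prod_(v in S) z v.

Definition stable f := forall z, (forall v, 0 < Im (z v)) -> setpoly f z != 0.

Lemma sum_set_split (M : nmodType) (F : {set V} -> M) (P : pred {set V}) i :
  (forall S, P (i |: S) = P S) ->
  \sum_(S : {set V} | P S) F S = \sum_(S : {set V} | P S && (i \notin S)) (F S + F (i |: S)).
Proof.
move=> Pi; rewrite (bigID (fun S => i \in S)) /= addrC big_split /=; congr (_ + _).
rewrite (reindex_onto (fun S => i |: S) (fun S => S :\ i)) /=; last first.
  by move=> S /andP[_ iS]; rewrite setD1K.
apply: eq_bigl => S; rewrite Pi setU11 andbT; congr (_ && _).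
by apply/eqP/idP => [<-|]; [rewrite !inE eqxx | exact: setU1K].
Qed.

Lemma sum_set_split2 (M : nmodType) (F : {set V} -> M) i j : i != j ->
  \sum_(S : {set V}) F S = \sum_(S : {set V} | (i \notin S) && (j \notin S))
    (F S + F (i |: S) + F (j |: S) + F (i |: (j |: S))).
Proof.
move=> ij; rewrite (@sum_set_split _ F predT i)//= (@sum_set_split _ _ _ j)/=; last first.
  by move=> S; rewrite !inE (negPf ij).
by apply: eq_bigr => S _; rewrite !addrA.
Qed.

Section Pair.
Variables (i j : V).
Hypothesis ij : i != j.

(** Applied to f and to its shifts by i, by j and by both, this yields the four coefficients of
    [setpoly] as a bilinear polynomial in z_i and z_j. *)
Let part f z := \sum_(S : {set V} | (i \notin S) && (j \notin S))
  (f S)%:C%C * \prod_(v in S) z v.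

Let prod_setU1 z x S : x \notin S ->
  \prod_(v in x |: S) z v = z x * \prod_(v in S) z v.
Proof. by move=> xS; rewrite big_setU1. Qed.

Lemma setpoly_pair f z : setpoly f z =
  part f z + part (fun S => f (i |: S)) z * z i + part (fun S => f (j |: S)) z * z j
  + part (fun S => f (i |: (j |: S))) z * (z i * z j).
Proof.
rewrite /setpoly (@sum_set_split2 _ _ _ _ ij) !mulr_suml -!big_split /=.
apply: eq_bigr => S /andP[iS jS].
rewrite !prod_setU1//; last by rewrite !inE (negPf ij).
by ring.
Qed.

Lemma part_congr f z z' : (forall v, v != i -> v != j -> z v = z' v) ->
  part f z = part f z'.
Proof.
move=> zz; apply: eq_bigr => S /andP[iS jS]; congr (_ * _); apply: eq_bigr => v vS.
by apply: zz; apply: contraTneq vS => ->.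
Qed.

Lemma stable_pair f z : stable f -> (forall v, 0 < Im (z v)) ->
  stable2 (part f z) (part (fun S => f (i |: S)) z)
    (part (fun S => f (j |: S)) z) (part (fun S => f (i |: (j |: S))) z).
Proof.
move=> st zH z1 z2 h1 h2.
pose z' v := if v == i then z1 else if v == j then z2 else z v.
have zz' v : v != i -> v != j -> z v = z' v by rewrite /z' => /negPf-> /negPf->.
have /st : forall v, 0 < Im (z' v) by move=> v; rewrite /z'; case: ifP => // _; case: ifP.
rewrite setpoly_pair -!(part_congr _ zz').
by rewrite /z' eqxx (eq_sym j) (negPf ij) eqxx.
Qed.

(** With the other variables frozen in the upper half-plane, passing from f to g is the coefficient
    change of [stable2_mix]. *)
Lemma stable_exchange f g (al be : R) : 0 < al -> 0 <= be -> 1 <= al + be ->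
  al - be <= 1 -> -1 <= al - be ->
  (forall S, i \notin S -> j \notin S ->
   [/\ g S = f S, g (i |: S) = al * f (i |: S) + be * f (j |: S),
       g (j |: S) = al * f (j |: S) + be * f (i |: S) &
       g (i |: (j |: S)) = f (i |: (j |: S))]) ->
  stable f -> stable g.
Proof.
move=> h1 h2 h3 h4 h5 gf st z zH.
rewrite setpoly_pair.
have := stable2_mix h1 h2 h3 h4 h5 (stable_pair st zH) (zH i) (zH j).
have -> : part g z = part f z.
  by apply: eq_bigr => S /andP[iS jS]; have [-> _ _ _] := gf S iS jS.
have -> : part (fun S => g (i |: (j |: S))) z = part (fun S => f (i |: (j |: S))) z.
  by apply: eq_bigr => S /andP[iS jS]; have [_ _ _ ->] := gf S iS jS.
have lin f1 f2 f3 : (forall S, i \notin S -> j \notin S -> f1 S = al * f2 S + be * f3 S) ->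
    part f1 z = al%:C%C * part f2 z + be%:C%C * part f3 z.
  move=> hf; rewrite /part !mulr_sumr -big_split /=; apply: eq_bigr => S /andP[iS jS].
  by rewrite hf// rmorphD !rmorphM /=; ring.
rewrite -(lin (fun S => g (i |: S))) => [|S iS jS]; last by have [] := gf S iS jS.
by rewrite -(lin (fun S => g (j |: S))) => [//|S iS jS]; have [] := gf S iS jS.
Qed.
End Pair.

(** This is h_e acting on coefficients. If S contains one end of e, [symdiff S e] moves that token
    along e; the two summands are the adjacency and degree parts. *)
Definition edge_op (th : R) e f S : R :=
  if #|S :&: e| == 1%N then f (symdiff S e) + th * f S else 0.

Definition step (th s : R) e f S := f S + s * edge_op th e f S.

Lemma stable_step (th s : R) e f : -1 <= th <= 1 -> 0 <= s < 1 -> #|e| = 2%N ->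
  stable f -> stable (step th s e f).
Proof.
move=> /andP[th0 th1] /andP[s0 s1] /eqP/cards2P[i [j [ij ->]]] st.
(* With s < 1, these two products make all conditions on al = 1 + s th and be = s linear. *)
have hsth : 0 <= s * (1 + th) by rewrite mulr_ge0//; lra.
have hsth1 : 0 <= s * (1 - th) by rewrite mulr_ge0//; lra.
apply: (@stable_exchange i j ij f _ (1 + s * th) s _ _ _ _ _ _ st) => //; try lra.
move=> S iS jS; rewrite /step /edge_op.
have inS x : x \in S -> (x != i) && (x != j).
  by move=> xS; apply/andP; split; apply: contraTneq xS => ->.
have I0 : S :&: [set i; j] = set0.
  apply/setP => x; rewrite !inE; apply/negP => /andP[/inS/andP[/negPf-> /negPf->]].
  by [].
have ji : (j == i) = false by rewrite eq_sym (negPf ij).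
have I1 : (i |: S) :&: [set i; j] = [set i].
  by rewrite setIUl I0 setU0; apply/setP => x; rewrite !inE; case: eqVneq.
have I2 : (j |: S) :&: [set i; j] = [set j].
  by rewrite setIUl I0 setU0; apply/setP => x; rewrite !inE; case: eqVneq; rewrite ?orbT.
have I3 : (i |: (j |: S)) :&: [set i; j] = [set i; j].
  by apply/setIidPr/subsetP => x; rewrite !inE => /orP[->|->]; rewrite ?orbT.
have D1 : symdiff (i |: S) [set i; j] = j |: S.
  apply/setP => x; rewrite /symdiff !inE; case: (eqVneq x i) => [->|xi] /=.
    by rewrite (negPf ij) (negPf iS).
  by case: (eqVneq x j) => [->|xj] /=; rewrite ?ji ?(negPf jS) ?andbF ?orbF.
have D2 : symdiff (j |: S) [set i; j] = i |: S.
  apply/setP => x; rewrite /symdiff !inE; case: (eqVneq x i) => [->|xi] /=.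
    by rewrite (negPf ij) (negPf iS).
  by case: (eqVneq x j) => [->|xj] /=; rewrite ?ji ?(negPf jS) ?andbF ?orbF.
rewrite I0 I1 I2 I3 !cards1 cards0 cards2 ij D1 D2 /= !mulr0 !addr0.
by split=> //; ring.
Qed.

Lemma stable_one : stable (fun=> 1).
Proof.
move=> z zH; rewrite /setpoly.
have -> : \sum_(S : {set V}) (1 : R)%:C%C * \prod_(v in S) z v = \prod_v (z v + 1).
  rewrite bigA_distr; apply: eq_bigr => S _.
  by rewrite mul1r [RHS]big_if /= [X in _ = _ * X]big1 ?mulr1.
apply/prodf_neq0 => v _; apply: contraTneq (zH v) => h.
have -> : z v = -1 by rewrite -[LHS](addrK 1) h add0r.
by rewrite /= oppr0 ltxx.
Qed.

(** Beyond stability, this keeps what Newton's inequalities require: nonnegative coefficients, a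
    positive constant term and degree exactly |V|. No edge meets the empty or full set in just one
    vertex, so those two values never change. *)
Definition admissible f :=
  [/\ stable f, forall S, 0 <= f S, f set0 = 1 & f setT = 1].

Lemma admissible_one : admissible (fun=> 1).
Proof. by split=> //; exact: stable_one. Qed.

Lemma admissible_step (th s : R) e f : -1 <= th <= 1 -> 0 <= s < 1 -> #|e| = 2%N ->
  admissible f -> admissible (step th s e f).
Proof.
move=> hth hs e2 [st f0 f1 f2]; split.
- exact: stable_step.
- move=> S; rewrite /step /edge_op; case: ifP => _; last by rewrite mulr0 addr0.
  have -> : f S + s * (f (symdiff S e) + th * f S) =
     (1 + s * th) * f S + s * f (symdiff S e) by ring.
  have /andP[th0 th1] := hth; have /andP[s0 s1] := hs.
  by rewrite addr_ge0// mulr_ge0//; have := mulr_ge0 s0 (_ : 0 <= 1 + th); nra.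
- by rewrite /step /edge_op set0I cards0 mulr0 addr0.
- by rewrite /step /edge_op setTI e2 mulr0 addr0.
Qed.

Definition level_sum f k := \sum_(S : {set V} | #|S| == k) f S.

Lemma admissible_ulc f : admissible f -> ultra_log_concave (level_sum f) #|V|.
Proof.
move=> [st fge0 f0 fT].
pose p := \sum_(S : {set V}) f S *: 'X^#|S|.
have pE k : p`_k = level_sum f k.
  rewrite coef_sum /level_sum [RHS]big_mkcond; apply: eq_bigr => S _ /=.
  by rewrite coefZ coefXn eq_sym; case: eqP; rewrite ?mulr1 ?mulr0.
have pn : p`_#|V| = 1.
  rewrite pE /level_sum (big_pred1 setT) // => S.
  by rewrite /= eqEcard subsetT cardsT eqn_leq max_card.
have p_big k : (#|V| < k)%N -> p`_k = 0.
  move=> kn; rewrite pE /level_sum big_pred0// => S.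
  by apply: contraTF kn => /eqP <-; rewrite -leqNgt max_card.
(* The exact degree makes the binomials those of |V|. *)
have sp : size p = #|V|.+1.
  apply/eqP; rewrite eqn_leq; apply/andP; split; first exact/leq_sizeP.
  by rewrite ltnNge; apply: contraL (oner_neq0 R) => /leq_sizeP h; rewrite -pn h// eqxx.
have := @ultra_log_concave_coef R p; rewrite sp /= => ulc k.
rewrite -!pE; apply: ulc.
- by move=> j; rewrite pE sumr_ge0.
- rewrite pE /level_sum (big_pred1 set0) ?f0// => S; exact: cards_eq0.
- move=> z zH; have := st (fun=> z) (fun=> zH).
  rewrite /setpoly rmorph_sum /= horner_sum.
  congr (is_true (_ != 0)); apply: eq_bigr => S _.
  by rewrite map_polyZ map_polyXn hornerZ hornerXn prodr_const.
Qed.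
End SetPolynomials.

(** * The Lie-Trotter limit *)

From mathcomp Require Import all_classical all_reals all_analysis.
Import numFieldNormedType.Exports.
Local Open Scope classical_set_scope.

(** Squeeze: with y = x/(m + 1), 1/(1 + y) = 1 - y/(1 + y) <= exp(-y/(1 + y)) gives exp(y/(1 + y))
    <= 1 + y <= exp(y). *)
Lemma cvg_compound_interest (R : realType) (x : R) : 0 <= x ->
  (1 + x / m.+1%:R) ^+ m.+1 @[m --> \oo] --> expR x.
Proof.
move=> x0; apply: (@squeeze_cvgr _ _ _ _ (fun m => expR (x / (1 + x / m.+1%:R))) (cst (expR x))).
- near=> m => /=; set y := x / m.+1%:R.
  have y0 : 0 <= y by rewrite divr_ge0.
  have y1 : 0 < 1 + y by rewrite ltr_wpDr.
  have -> : x / (1 + y) = m.+1%:R * (y / (1 + y)).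
    by rewrite mulrA [_ * y]mulrC /y divfK.
  have xE : x = m.+1%:R * y by rewrite mulrC /y divfK.
  rewrite xE !expRM_natl !lerXn2r ?nnegrE ?expR_ge0 ?expR_ge1Dx//=; try exact: ltW.
  have := expR_ge1Dx (- (y / (1 + y))); rewrite expRN.
  have -> : 1 - y / (1 + y) = (1 + y)^-1 by field; rewrite gt_eqF.
  by rewrite lef_pV2// posrE expR_gt0.
- apply: continuous_cvg; first exact: continuous_expR.
  rewrite -[X in _ --> X]divr1; apply: cvgM; first exact: cvg_cst.
  apply: cvgV; first by rewrite oner_eq0.
  rewrite -[X in _ --> X]addr0; apply: cvgD; first exact: cvg_cst.
  rewrite -[X in _ --> X](mulr0 x); apply: cvgM; first exact: cvg_cst.
  exact: cvg_harmonic.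
- exact: cvg_cst.
Unshelve. all: by end_near. Qed.

(** * Operator iterates bounded by scalar exponentials *)

Section Majorant.
Variables (R : realType) (X : Type).
Implicit Types (f g : X -> R) (A H P : (X -> R) -> (X -> R)).

(** Supremum-norm operator bound, phrased pointwise so that [X] may be any type. *)
Definition op_le (K : R) A := forall (c : R) f,
  (forall x, `|f x| <= c) -> forall x, `|A f x| <= K * c.

Lemma op_le_iter K A m : op_le K A -> op_le (K ^+ m) (iter m A).
Proof.
move=> hA; elim: m => [|m IH] c f fc x /=; first by rewrite mul1r.
by rewrite exprS -mulrA; apply: hA; exact: IH.
Qed.

Variables (H : (X -> R) -> (X -> R)) (K : R).
Hypotheses (K0 : 0 <= K) (HK : op_le K H).
Hypothesis Hlin : forall n (c : nat -> R) (F : nat -> X -> R) x,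
  H (fun y => \sum_(j < n) c j * F j y) x = \sum_(j < n) c j * H (F j) x.

Definition euler s f x := f x + s * H f x.

(** The binomial theorem for (1 + s H)^m, by Pascal's rule. *)
Lemma iter_euler s m f : iter m (euler s) f =
  (fun x => \sum_(j < m.+1) 'C(m, j)%:R * s ^+ j * iter j H f x).
Proof.
elim: m => [|m IH]; apply/funext => x.
  by rewrite big_ord1 bin0 expr0 !mul1r.
rewrite iterS IH /euler (Hlin m.+1 (fun j => 'C(m, j)%:R * s ^+ j) (fun j => iter j H f)).
rewrite [RHS]big_ord_recl /= bin0 expr0 !mul1r.
under [in RHS]eq_bigr => j _ do rewrite /bump /= add1n binS natrD !mulrDl.
rewrite big_split /= addrA; congr (_ + _).
  rewrite big_ord_recl bin0 expr0 !mul1r; congr (_ + _).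
  rewrite [RHS]big_ord_recr /= bin_small// !mul0r addr0.
  by apply: eq_bigr => j _; rewrite /bump /= add1n.
by rewrite mulr_sumr; apply: eq_bigr => j _; rewrite exprS; ring.
Qed.

Lemma op_le_euler s : 0 <= s -> op_le (1 + s * K) (euler s).
Proof.
move=> s0 c f fc x; apply: le_trans (ler_normD _ _) _.
rewrite mulrDl mul1r lerD// normrM (ger0_norm s0) -mulrA ler_wpM2l//.
exact: HK.
Qed.

(* The coefficients 1/j! - C(m, j)/m^j of the difference are nonnegative, so it
   is majorized by the same difference at the scalar t K. *)
Lemma euler_exp_dist (t : R) m c f x : 0 <= t -> (forall y, `|f y| <= c) ->
  `|iter m.+1 (euler (t / m.+1%:R)) f x - \sum_(j < m.+2) j`!%:R^-1 * t ^+ j * iter j H f x|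
  <= (expR (t * K) - (1 + t * K / m.+1%:R) ^+ m.+1) * c.
Proof.
move=> t0 fc.
have c0 : 0 <= c := le_trans (normr_ge0 _) (fc x).
rewrite distrC iter_euler -sumrB.
pose d j : R := j`!%:R^-1 - 'C(m.+1, j)%:R / m.+1%:R ^+ j.
have d0 j : 0 <= d j.
  rewrite subr_ge0 ler_pdivrMr ?exprn_gt0// ler_pdivlMl ?ltr0n ?fact_gt0//.
  (* C(m+1, j) j! is a falling factorial: j factors, each at most m + 1. *)
  rewrite -!natrX -natrM ler_nat mulnC bin_ffact.
  have [jm|jm] := leqP j m.+1; last by rewrite ffact_small.
  elim: j jm => // j IH jm; rewrite ffactnSr expnSr leq_mul ?leq_subr//.
  by rewrite IH// ltnW.
apply: le_trans (ler_norm_sum _ _ _) _.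
apply: (@le_trans _ _ (\sum_(j < m.+2) d j * (t * K) ^+ j * c)).
  apply: ler_sum => j _.
  have -> : j`!%:R^-1 * t ^+ j * iter j H f x - 'C(m.+1, j)%:R * (t / m.+1%:R) ^+ j * iter j H f x
     = d j * t ^+ j * iter j H f x by rewrite /d exprMn exprVn; ring.
  rewrite !normrM (ger0_norm (d0 _)) ger0_norm ?exprn_ge0// exprMn -!mulrA.
  rewrite ler_wpM2l// ler_wpM2l ?exprn_ge0//; exact: (op_le_iter j HK).
rewrite -mulr_suml ler_wpM2r//.
have -> : \sum_(j < m.+2) d j * (t * K) ^+ j = series (exp_coeff (t * K)) m.+2 -
    (1 + t * K / m.+1%:R) ^+ m.+1.
  rewrite /series /= big_mkord (addrC 1) exprD1n -sumrB; apply: eq_bigr => j _.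
  rewrite /d /exp_coeff /= [(_ / _) ^+ j]exprMn exprVn -mulr_natl; ring.
rewrite lerD2r; apply: nondecreasing_cvgn_le.
  by apply/nondecreasing_seqP => n; rewrite seriesSr lerDl exp_coeff_ge0// mulr_ge0.
exact: is_cvg_series_exp_coeff.
Qed.

Variables (P : (X -> R) -> (X -> R)) (s : R).
Hypotheses (s0 : 0 <= s) (PK : op_le (expR (s * K)) P).
Hypothesis Psub : forall f g x, P (fun y => f y - g y) x = P f x - P g x.
Hypothesis PH : op_le (expR (s * K) - 1 - s * K) (fun f x => P f x - euler s f x).

(** Telescoping: P^(m+1) - Q^(m+1) = P (P^m - Q^m) + (P - Q) Q^m with Q the Euler step. The scalars
    exp(s K) and 1 + s K obey the same identity, so the bound closes exactly. *)
Lemma iter_euler_dist m c f x : (forall y, `|f y| <= c) ->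
  `|iter m P f x - iter m (euler s) f x| <= (expR (s * K) ^+ m - (1 + s * K) ^+ m) * c.
Proof.
move=> fc; elim: m x => [|m IH] x /=; first by rewrite !subrr normr0 mul0r.
have -> : P (iter m P f) x - euler s (iter m (euler s) f) x =
    P (fun y => iter m P f y - iter m (euler s) f y) x +
    (P (iter m (euler s) f) x - euler s (iter m (euler s) f) x).
  by rewrite Psub; ring.
apply: le_trans (ler_normD _ _) _.
have h1 := PK IH x.
have h2 := PH (op_le_iter m (op_le_euler s0) fc) x.
apply: le_trans (lerD h1 h2) _.
by rewrite !exprS le_eqVlt; apply/orP; left; apply/eqP; ring.
Qed.
End Majorant.

(** * Products of edge steps and their limit *)

Section Trotter.
Variables (R : realType) (V : finType) (w : {set V} -> R) (th : R).
Hypothesis hth : -1 <= th <= 1.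
Implicit Types (f g : {set V} -> R) (S e : {set V}) (es : seq {set V}).

Definition ham es f S := \sum_(e <- es) w e * edge_op th e f S.

Definition trotter (s : R) es f := foldr (fun e g => step th (s * w e) e g) f es.

(** A norm bound for [ham]; the factor 2 is the bound of one [edge_op]. *)
Definition wsum es := \sum_(e <- es) 2 * w e.

Lemma edge_op_le e : op_le 2 (edge_op th e).
Proof.
move=> c f fc S; rewrite /edge_op; case: ifP => _; last first.
  by rewrite normr0 mulr_ge0// (le_trans _ (fc S)).
apply: le_trans (ler_normD _ _) _; rewrite mulrDl mul1r lerD//.
rewrite normrM -[leRHS]mul1r ler_pM// ler_norml; exact: hth.
Qed.

Lemma edge_op_sub e f g S :
  edge_op th e (fun T => f T - g T) S = edge_op th e f S - edge_op th e g S.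
Proof. by rewrite /edge_op; case: ifP => _; ring. Qed.

Lemma ham_lin es n (c : nat -> R) (F : nat -> {set V} -> R) S :
  ham es (fun T => \sum_(j < n) c j * F j T) S = \sum_(j < n) c j * ham es (F j) S.
Proof.
under [RHS]eq_bigr do rewrite mulr_sumr.
rewrite exchange_big /=; apply: eq_bigr => e _; rewrite /edge_op; case: ifP => _.
  rewrite mulr_sumr -big_split /= mulr_sumr; apply: eq_bigr => j _; ring.
by rewrite mulr0 big1// => j _; rewrite !mulr0.
Qed.

Section Nonneg.
Variable es : seq {set V}.
Hypothesis w0 : forall e, e \in es -> 0 <= w e.

Lemma ham_le : op_le (wsum es) (ham es).
Proof.
move=> c f fc S; rewrite /ham /wsum mulr_suml.
apply: le_trans (ler_norm_sum _ _ _) _; rewrite !big_seq; apply: ler_sum => e ees.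
rewrite normrM (ger0_norm (w0 ees)) (mulrC 2) -mulrA ler_wpM2l ?w0//.
exact: edge_op_le.
Qed.

Lemma wsum_ge0 : 0 <= wsum es.
Proof. by rewrite /wsum big_seq sumr_ge0// => e /w0; exact: mulr_ge0. Qed.
End Nonneg.

Lemma trotter_sub s es f g S :
  trotter s es (fun T => f T - g T) S = trotter s es f S - trotter s es g S.
Proof.
elim: es S => //= e es IH S; rewrite /step IH.
rewrite (_ : trotter s es (fun T => f T - g T) = fun T =>
  trotter s es f T - trotter s es g T); last exact/funext/IH.
by rewrite edge_op_sub; ring.
Qed.

(* Expanding the product of the factors 1 + s w_e h_e, each term is bounded by
   the corresponding term in the expansion of exp(s K) = prod_e exp(2 s w_e). *)
Lemma trotter_bounds (s : R) es : 0 <= s -> (forall e, e \in es -> 0 <= w e) ->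
  [/\ op_le (expR (s * wsum es)) (trotter s es),
      op_le (expR (s * wsum es) - 1) (fun f S => trotter s es f S - f S) &
      op_le (expR (s * wsum es) - 1 - s * wsum es)
        (fun f S => trotter s es f S - euler (ham es) s f S)].
Proof.
move=> s0; elim: es => [|e es IH] w0.
  rewrite /wsum big_nil mulr0 expR0; split=> c f fc S /=; rewrite ?mul1r//.
    by rewrite !subrr normr0 mul0r.
  by rewrite /euler /ham big_nil mulr0 addr0 !subrr normr0 mul0r.
have [h1 h2 h3] := IH (fun e' h => w0 e' (mem_behead (s := e :: es) h)).
have we0 : 0 <= s * w e by rewrite mulr_ge0// w0 ?mem_head.
set K := wsum es in h1 h2 h3; set k := s * w e in we0 *.
have -> : s * wsum (e :: es) = 2 * k + s * K by rewrite [wsum _]big_cons -/(wsum es) -/K /k; ring.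
(* All three bounds reduce to (1 + 2k) exp(s K) <= exp(2k + s K); the second one feeds the third. *)
have ek : 1 + 2 * k <= expR (2 * k) by exact: expR_ge1Dx.
have e0 : 0 <= expR (s * K) by exact: expR_ge0.
have ekK := ler_wpM2r e0 ek.
rewrite -expRD in ekK.
split=> c f fc S /=; rewrite /step -/k; have c0 := le_trans (normr_ge0 _) (fc S).
- have b1 := h1 c f fc S.
  have b2 := @edge_op_le e _ _ (h1 c f fc) S.
  apply: le_trans (ler_normD _ _) _; rewrite normrM (ger0_norm we0).
  apply: le_trans (lerD b1 (ler_wpM2l we0 b2)) _.
  apply: le_trans (ler_wpM2r c0 ekK); rewrite le_eqVlt; apply/orP; left; apply/eqP; ring.
- have b1 := h2 c f fc S.
  have b2 := @edge_op_le e _ _ (h1 c f fc) S.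
  rewrite addrAC; apply: le_trans (ler_normD _ _) _; rewrite normrM (ger0_norm we0).
  apply: le_trans (lerD b1 (ler_wpM2l we0 b2)) _.
  have := ler_wpM2r c0 ekK; lra.
- have b1 := h3 c f fc S.
  have b2 := @edge_op_le e _ _ (h2 c f fc) S.
  rewrite edge_op_sub in b2.
  have -> : trotter s es f S + k * edge_op th e (trotter s es f) S - euler (ham (e :: es)) s f S
    = (trotter s es f S - euler (ham es) s f S) +
      k * (edge_op th e (trotter s es f) S - edge_op th e f S).
    by rewrite /euler /ham big_cons /k; ring.
  apply: le_trans (ler_normD _ _) _; rewrite normrM (ger0_norm we0).
  apply: le_trans (lerD b1 (ler_wpM2l we0 b2)) _.
  have := ler_wpM2r c0 ekK; lra.
Qed.

(** The Euler iterates serve as intermediary: they are close both to the Trotter product and to the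
    truncated exponential. *)
Lemma trotter_cvg (t : R) es f S : 0 <= t -> (forall e, e \in es -> 0 <= w e) ->
  iter m.+1 (trotter (t / m.+1%:R) es) f S -
    \sum_(j < m.+2) j`!%:R^-1 * t ^+ j * iter j (ham es) f S @[m --> \oo] --> (0 : R).
Proof.
move=> t0 w0; pose K := wsum es; pose c : R := \sum_T `|f T|.
have fc T : `|f T| <= c by rewrite /c (bigD1 T)//= lerDl sumr_ge0.
(* Each of the two distances has the same bound, hence the factor 2. *)
pose bnd m := 2 * (expR (t * K) - (1 + t * K / m.+1%:R) ^+ m.+1) * c.
have tK0 : 0 <= t * K by rewrite mulr_ge0// wsum_ge0.
have bnd0 : bnd m @[m --> \oo] --> (0 : R).
  rewrite (_ : 0 = 2 * (expR (t * K) - expR (t * K)) * c); last by rewrite subrr mulr0 mul0r.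
  apply: cvgMl; apply: cvgMr; apply: cvgB; first exact: cvg_cst.
  exact: cvg_compound_interest.
apply: norm_cvg0; apply: (@squeeze_cvgr _ _ _ _ (cst 0) bnd) => //; last exact: cvg_cst.
near=> m; rewrite normr_ge0 /=.
set s := t / m.+1%:R; have s0 : 0 <= s by rewrite divr_ge0.
have [h1 _ h3] := trotter_bounds s0 w0.
have K0 := wsum_ge0 w0.
have d1 := euler_exp_dist K0 (ham_le w0) (@ham_lin es) m S t0 fc.
have d2 := iter_euler_dist (ham_le w0) s0 h1 (trotter_sub s es) h3 m.+1 S fc.
rewrite -[X in `|X|](subrKA (iter m.+1 (euler (ham es) s) f S)).
apply: le_trans (ler_normD _ _) _; apply: le_trans (lerD d2 d1) _.
rewrite -expRM_natl -/K /bnd.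
have -> : m.+1%:R * (s * K) = t * K by rewrite mulrA [_ * s]mulrC /s divfK.
have -> : s * K = t * K / m.+1%:R by rewrite /s mulrAC.
rewrite le_eqVlt; apply/orP; left; apply/eqP; ring.
Unshelve. all: by end_near. Qed.

Lemma admissible_trotter (s : R) es f :
  (forall e, e \in es -> #|e| = 2%N /\ 0 <= s * w e < 1) ->
  admissible f -> admissible (trotter s es f).
Proof.
elim: es => //= e es IH hes fa.
have [e2 se] := hes e (mem_head _ _).
apply: admissible_step => //; apply: IH => // e' e'es.
by apply: hes; rewrite inE e'es orbT.
Qed.
End Trotter.

(** * Token graphs *)

(** Completeness of matrix spaces, for absolute convergence of the exponential series. *)
HB.instance Definition _ (R : realType) (m n : nat) := Complete.on 'M[R]_(m, n).

Lemma cvg_sumr (R : realType) (I : Type) (r : seq I) (Q : pred I)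
    (u : I -> nat -> R) (a : I -> R) :
  (forall i, Q i -> u i m @[m --> \oo] --> a i) ->
  \sum_(i <- r | Q i) u i m @[m --> \oo] --> \sum_(i <- r | Q i) a i.
Proof. by apply: cvg_big; exact: add_continuous. Qed.

(** * Convergence of the matrix exponential *)

Section MatrixExponential.
Variables (R : realType) (n : nat).
Implicit Types M A B : 'M[R]_n.

Lemma mx_norm_leP M (c : R) : 0 <= c -> (forall i j, `|M i j| <= c) -> `|M| <= c.
Proof.
move=> c0 h; rewrite [leLHS]mx_normrE; by apply/bigmax_leP; split.
Qed.

Lemma entry_le_norm M i j : `|M i j| <= `|M|.
Proof.
rewrite [leRHS]mx_normrE.
exact: (le_bigmax _ (fun ij : 'I_n * 'I_n => `|M ij.1 ij.2|) (i, j)).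
Qed.

(** The norm is the largest absolute entry; the n products in an entry of [A *m B] cost a factor
    n. *)
Lemma mulmx_norm_le A B : `|A *m B| <= n%:R * `|A| * `|B|.
Proof.
apply: mx_norm_leP => [|i j]; first by rewrite !mulr_ge0.
rewrite mxE; apply: le_trans (ler_norm_sum _ _ _) _.
apply: (@le_trans _ _ (\sum_(k < n) `|A| * `|B|)).
  by apply: ler_sum => k _; rewrite normrM ler_pM// entry_le_norm.
by rewrite sumr_const card_ord -mulrA mulr_natl.
Qed.

Lemma exprmx_norm_le M m : `|M ^+ m| <= (n%:R * `|M|) ^+ m.
Proof.
elim: m => [|m IH].
  rewrite !expr0; apply: mx_norm_leP => // i j.
  by rewrite mxE; case: (i == j); rewrite ?normr1 ?normr0.
rewrite !exprS; apply: le_trans (mulmx_norm_le _ _) _.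
by rewrite ler_wpM2l// mulr_ge0.
Qed.

(** Norms of the terms are dominated by the scalar exponential series at n |M|. *)
Lemma is_cvg_expmx M : cvgn (series (fun m => m`!%:R^-1 *: M ^+ m)).
Proof.
apply: normed_cvg; apply: series_le_cvg (is_cvg_series_exp_coeff (n%:R * `|M|)).
- by move=> m; exact: normr_ge0.
- by move=> m; rewrite exp_coeff_ge0// mulr_ge0.
- move=> m /=; rewrite normrZ ger0_norm ?invr_ge0// /exp_coeff mulrC.
  by rewrite ler_pM// exprmx_norm_le.
Qed.

Lemma expmx_entry_cvg M i j :
  \sum_(0 <= m < k) m`!%:R^-1 * (M ^+ m) i j @[k --> \oo] --> expmx M i j.
Proof.
have cvgM := continuous_cvg _ (@coord_continuous R n n i j (expmx M)) (@is_cvg_expmx M).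
have -> : (fun k => \sum_(0 <= m < k) m`!%:R^-1 * (M ^+ m) i j) =
    (fun k => series (fun m => m`!%:R^-1 *: M ^+ m) k i j); last exact: cvgM.
by apply/funext => k; rewrite /series /= summxE; apply: eq_bigr => m _; rewrite mxE.
Qed.
End MatrixExponential.

(** * Token matrices as levels of one operator on set functions *)

Section TokenGraphs.
Variables (R : realType) (V : finType) (E : {set {set V}}) (w : {set V} -> R) (th : R).
Hypothesis hE : forall e, e \in E -> #|e| = 2%N.
Implicit Types (f : {set V} -> R) (S e : {set V}).

Local Notation Ham := (ham w th (enum E)).

Lemma symdiffK S : involutive (symdiff S).
Proof.
by move=> e; apply/setP => x; rewrite !inE; case: (x \in S); case: (x \in e).
Qed.

Lemma card_symdiff_edge S e : #|e| = 2%N -> (#|symdiff S e| == #|S|) = (#|S :&: e| == 1%N).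
Proof.
move=> e2; rewrite /symdiff cardsU.
have -> : (S :\: e) :&: (e :\: S) = finset.set0.
  by apply/setP => x; rewrite !inE; case: (x \in S); rewrite /= ?andbF.
have := cardsID e S; have := cardsID S e; rewrite finset.setIC e2 cards0.
by lia.
Qed.

(** [ham] preserves cardinality, and on k-subsets it is [token_H]: substituting T = [symdiff S e]
    turns a row sum over k-subsets T into a sum over edges e. *)
Lemma token_H_col k f :
  token_H E w th k *m (\col_i f (enum_val i)) = \col_i Ham f (enum_val i).
Proof.
apply/matrixP => i j; rewrite {j}(ord1 j) !mxE.
set S := enum_val i.
have Sk : #|S| = k by have := enum_valP i; rewrite inE => /eqP.
under eq_bigr do rewrite !mxE mulrDl.
rewrite big_split /=.
have -> : \sum_(l < #|ksubsets k|) th * (token_deg E w S *+ (i == l)) * f (enum_val l)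
   = th * token_deg E w S * f S.
  rewrite (bigD1 i)//= eqxx mulr1n big1 ?addr0// => l li.
  by rewrite eq_sym (negPf li) mulr0 mul0r.
pose G D := if D \in E then w D else 0.
have -> : \sum_(l < #|ksubsets k|)
    (if symdiff S (enum_val l) \in E then w (symdiff S (enum_val l)) else 0) * f (enum_val l)
  = \sum_(T in ksubsets k) G (symdiff S T) * f T.
  by rewrite [RHS]big_enum_val.
rewrite (reindex_inj (inv_inj (@symdiffK S))) /=.
under eq_bigr do rewrite symdiffK.
rewrite /ham big_enum /= /token_deg mulr_sumr mulr_suml.
rewrite big_mkcond [X in _ + X]big_mkcond -big_split [RHS]big_mkcond /=.
apply: eq_bigr => e _; rewrite /G /edge_op inE -Sk.
have [eE|_] /= := boolP (e \in E); last by rewrite mul0r if_same addr0.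
rewrite (card_symdiff_edge S (hE eE)); case: ifP => _; rewrite ?mulr0 ?addr0//.
by ring.
Qed.

Lemma exp_token_H_col (t : R) k m f :
  (t *: token_H E w th k) ^+ m *m (\col_i f (enum_val i)) =
  t ^+ m *: (\col_i iter m Ham f (enum_val i)).
Proof.
elim: m => [|m IH]; first by rewrite !expr0 mul1mx scale1r.
rewrite exprS -mulmxE -mulmxA IH -scalemxAr -scalemxAl token_H_col.
by rewrite scalerA exprS mulrC.
Qed.

Lemma token_a_cvg (t : R) k :
  level_sum (fun S => \sum_(j < m.+2) j`!%:R^-1 * t ^+ j * iter j Ham (fun=> 1) S) k
  @[m --> \oo] --> token_a E w th k t.
Proof.
set M := t *: token_H E w th k.
have aE : token_a E w th k t = \sum_j \sum_i expmx M i j.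
  rewrite /token_a mxE; apply: eq_bigr => j _.
  rewrite !mxE mulr1; apply: eq_bigr => i _; by rewrite !mxE mul1r.
rewrite aE.
have cvgM : \sum_j \sum_i (\sum_(0 <= m < k0) m`!%:R^-1 * (M ^+ m) i j) @[k0 --> \oo]
    --> \sum_j \sum_i expmx M i j.
  by apply: cvg_sumr => j _; apply: cvg_sumr => i _; exact: expmx_entry_cvg.
(* Shifted by 2 to match sums with m + 2 terms. *)
have := cvg_comp _ _ (cvg_addnr 2) cvgM.
apply: cvg_trans; apply: near_eq_cvg; near=> m.
rewrite /= addn2 exchange_big /= /level_sum.
rewrite (eq_bigl (fun S => S \in ksubsets k)); last by move=> S; rewrite inE.
rewrite [RHS]big_enum_val; apply: eq_bigr => i _.
rewrite exchange_big /= big_mkord; apply: eq_bigr => l _.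
rewrite -mulr_sumr -mulrA; congr (_ * _).
have := congr1 (fun A : 'cV[R]__ => A i 0) (exp_token_H_col t k l (fun=> 1)).
rewrite !mxE => <-; apply: eq_bigr => j _; by rewrite mxE mulr1.
Unshelve. all: by end_near. Qed.
End TokenGraphs.

Theorem theorem1p2 (R : realType) (V : finType)
  (E : {set {set V}}) (w : {set V} -> R)
  (hE : forall e : {set V}, e \in E -> #|e| = 2%N)
  (hw : forall e : {set V}, e \in E -> 0 <= w e)
  (t theta : R) (ht : 0 <= t) (htheta : -1 <= theta <= 1)
  (k : nat) (hk : (1 <= k <= #|V| - 1)%N) :
  (token_a E w theta k t / 'C(#|V|, k)%:R) ^+ 2 >=
  (token_a E w theta (k - 1) t / 'C(#|V|, k - 1)%:R) *
  (token_a E w theta (k + 1) t / 'C(#|V|, k + 1)%:R).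
Proof.
pose u m := iter m.+1 (trotter w theta (t / m.+1%:R) (enum E)) (fun=> 1).
have w0 e : e \in enum E -> 0 <= w e by rewrite mem_enum => /hw.
have ucvg j : level_sum (u m) j @[m --> \oo] --> token_a E w theta j t.
  pose v m S := \sum_(i < m.+2) i`!%:R^-1 * t ^+ i *
    iter i (ham w theta (enum E)) (fun=> 1) S.
  (* Here u - v tends to 0 by [trotter_cvg], and the level sums of v tend to [token_a]. *)
  have uE : (fun m => level_sum (u m) j) =
      (fun m => level_sum (fun S => u m S - v m S) j + level_sum (v m) j).
    by apply/funext => m; rewrite /level_sum -big_split; apply: eq_bigr => S _ /=; rewrite subrK.
  rewrite uE -[X in _ --> X]add0r; apply: cvgD; last exact: token_a_cvg.
  rewrite [X in _ --> X](_ : 0 = \sum_(S : {set V} | #|S| == j) (0 : R)); last by rewrite big1.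
  by apply: cvg_sumr => S _; exact: trotter_cvg.
have ulc : \forall m \near \oo, ultra_log_concave (level_sum (u m)) #|V|.
  near=> m; apply: admissible_ulc.
  (* Only the number of iterations is generalized; the step size stays t/(m + 1). *)
  rewrite /u; elim: {1}m.+1 => [|i IH]; first exact: admissible_one.
  rewrite iterS; apply: admissible_trotter => // e eE.
  have eE' : e \in E by rewrite -mem_enum.
  split; first exact: hE.
  rewrite mulr_ge0 ?w0 ?divr_ge0//= mulrAC ltr_pdivrMr// mul1r.
  (* Once m exceeds the total weight times t, every edge step is below 1. *)
  apply: (@le_lt_trans _ _ (\sum_(e in E) t * w e)).
    rewrite (bigD1 e)//= lerDl sumr_ge0// => e' /andP[e'E _].
    by rewrite mulr_ge0// hw.
  apply: (@lt_trans _ _ m%:R); last by rewrite ltr_nat.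
  by near: m; exact: nbhs_infty_gtr.
have k0 : (0 < k < #|V|)%N by move: hk; lia.
rewrite subn1 addn1.
have divc j : level_sum (u m) j / 'C(#|V|, j)%:R @[m --> \oo] -->
    token_a E w theta j t / 'C(#|V|, j)%:R.
  by apply: cvgMl; exact: ucvg.
rewrite expr2; apply: (ler_cvg_to (cvgM (divc k.-1) (divc k.+1)) (cvgM (divc k) (divc k))).
by apply: filterS ulc => m /(_ k k0); rewrite expr2.
Unshelve. all: by end_near. Qed.
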